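(* Let $k$ be a field and $a,b,c$ positive integers. The group of $k$-linear autotopisms of the matrix multiplication $*:\mathbb{M}_{a\times b}(k)\times\mathbb{M}_{b\times c}(k)\to\mathbb{M}_{a\times c}(k)$ is $$\mathrm{Aut}_k( * )=\mathrm{Inn}( * )\cong\frac{\mathrm{GL}_a(k)\times\mathrm{GL}_b(k)\times\mathrm{GL}_c(k)}{\{(sI_a,sI_b,sI_c):s\in k^\times\}}.$$
   Context: For a $k$-bilinear map $*:U\times V\to W$, a $k$-linear autotopism is a triple $(f,g;h)\in\mathrm{GL}_k(U)\times\mathrm{GL}_k(V)\times\mathrm{GL}_k(W)$ with $uf*vg=(u*v)h$ for all $u\in U,v\in V$ (operators written on the right); these form the group $\mathrm{Aut}_k( * )$. $\mathcal{L}_*$ is the ring of pairs $\lambda$ of $k$-endomorphisms of $U$ and of $W$ (written on the left) with $(\lambda u)*v=\lambda(u*v)$; $\mathcal{M}_*$ is the ring of pairs $\mu$ of $k$-endomorphisms $u\mapsto u\mu$ of $U$ and $v\mapsto\mu v$ of $V$ with $(u\mu)*v=u*(\mu v)$; $\mathcal{R}_*$ is the ring of pairs $\rho$ of $k$-endomorphisms of $V$ and of $W$ (written on the right) with $u*(v\rho)=(u*v)\rho$. Put $\mathcal{LMR}_*=\mathcal{L}_*\oplus\mathcal{M}_*\oplus\mathcal{R}_*$. The centroid $\mathcal{C}_*$ is the ring of triples $\sigma$ of additive endomorphisms of $U,V,W$ with $(u\sigma)*v=(u*v)\sigma=u*(v\sigma)$, embedded diagonally in $\mathcal{LMR}_*$.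 The inner autotopisms are $$\mathrm{Inn}( * )=\{(u\mapsto\lambda^{-1}u\mu,\ v\mapsto\mu^{-1}v\rho;\ w\mapsto\lambda^{-1}w\rho):(\lambda,\mu,\rho)\in\mathcal{LMR}_*^\times\}\cong\mathcal{LMR}_*^\times/\mathcal{C}_*^\times.$$ *)

(* Defs.v *)
From HB Require Import structures.
From mathcomp Require Import all_boot all_algebra.
From mathcomp Require Import boolp.

Set Implicit Arguments.
Unset Strict Implicit.
Unset Printing Implicit Defensive.

Import GRing.Theory.
Local Open Scope ring_scope.

Definition isomorphic (G H : groupType) : Prop :=
  exists f : {multiplicative G -> H}, bijective f.

Section Subgroup.
Variables (G : groupType) (S : {pred G}).

Record subgroup (gS : group_closed S) :=
  Subgroup {sgrp_val : G; _ : sgrp_val \in S}.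

Variable gS : group_closed S.
HB.instance Definition _ := [isSub for @sgrp_val gS].
HB.instance Definition _ := [Choice of subgroup gS by <:].
HB.instance Definition _ := SubChoice_isSubGroup.Build G _ (subgroup gS) gS.

End Subgroup.

Definition conj_closed (G : groupType) (S : {pred G}) : Prop :=
  forall x y : G, x \in S -> (x ^ y)%g \in S.

Section QuotientGroup.
Variables (G : groupType) (N : {pred G}).
Hypotheses (gN : group_closed N) (nN : conj_closed N).
Local Open Scope group_scope.
Local Open Scope quotient_scope.

Let gpred1 : 1 \in N. Proof. by case: gN. Qed.
Let gpredM x y : x \in N -> y \in N -> x * y \in N.
Proof. exact: group_closedM. Qed.
Let gpredVr x : x \in N -> x^-1 \in N.
Proof. exact: group_closedV. Qed.

Definition cosetr : rel G := fun x y => x^-1 * y \in N.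

Lemma cosetr_refl : reflexive cosetr.
Proof. by move=> x; rewrite /cosetr mulVg gpred1. Qed.

Lemma cosetr_sym : symmetric cosetr.
Proof.
suff sub x y : cosetr x y -> cosetr y x by move=> x y; apply/idP/idP; apply: sub.
by move=> /gpredVr; rewrite /cosetr invgM invgK.
Qed.

Lemma cosetr_trans : transitive cosetr.
Proof.
by move=> y x z /gpredM xy /xy; rewrite /cosetr mulgA mulgK.
Qed.

Canonical cosetr_equiv := EquivRel cosetr cosetr_refl cosetr_sym cosetr_trans.

(* The (unused) normality argument lets the group structure be inferred from  *)
(* the type.                                                                  *)
Definition quotient_group of conj_closed N := {eq_quot cosetr_equiv}.
Local Notation Q := (quotient_group nN).
HB.instance Definition _ := Choice.on Q.
HB.instance Definition _ := EqQuotient.on Q.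

Definition qone : Q := \pi_Q 1.
Definition qmul (x y : Q) : Q :=
  \pi_Q (repr x * repr y).
Definition qinv (x : Q) : Q :=
  \pi_Q (repr x)^-1.

Lemma cosetrP (x y : G) :
  reflect (\pi_Q x = \pi_Q y) (cosetr x y).
Proof. by apply: (iffP idP) => [xy|/eqmodP //]; apply/eqmodP. Qed.

Lemma quotient_groupP (x : Q) : exists y, x = \pi_Q y.
Proof. by exists (repr x); rewrite reprK. Qed.

Lemma cosetr_repr (x : G) : cosetr (repr (\pi_Q x)) x.
Proof. by apply/cosetrP; rewrite reprK. Qed.

Lemma qmulE (x y : G) :
  qmul (\pi_Q x) (\pi_Q y) = \pi_Q (x * y).
Proof.
apply/cosetrP; move: (cosetr_repr x) (cosetr_repr y).
set x' := repr _; set y' := repr _; rewrite /cosetr => Nx Ny.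
have -> : (x' * y')^-1 * (x * y) = (x'^-1 * x) ^ y' * (y'^-1 * y).
  by rewrite /conjg invgM !mulgA mulgK.
by rewrite gpredM ?nN.
Qed.

Lemma qinvE (x : G) : qinv (\pi_Q x) = \pi_Q x^-1.
Proof.
apply/cosetrP; move: (cosetr_repr x).
set x' := repr _; rewrite /cosetr => /gpredVr /(@nN _ x^-1).
by rewrite /conjg !invgK invgM invgK !mulgA mulgV mul1g.
Qed.

Lemma qmulA : associative qmul.
Proof.
move=> x y z; have [x' ->] := quotient_groupP x.
have [[y' ->] [z' ->]] := (quotient_groupP y, quotient_groupP z).
by rewrite !qmulE mulgA.
Qed.

Lemma qmul1 : left_id qone qmul.
Proof. by move=> x; have [y ->] := quotient_groupP x; rewrite qmulE mul1g. Qed.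

Lemma q1mul : right_id qone qmul.
Proof. by move=> x; have [y ->] := quotient_groupP x; rewrite qmulE mulg1. Qed.

Lemma qmulV : left_inverse qone qinv qmul.
Proof. by move=> x; have [y ->] := quotient_groupP x; rewrite qinvE qmulE mulVg. Qed.

Lemma qVmul : right_inverse qone qinv qmul.
Proof. by move=> x; have [y ->] := quotient_groupP x; rewrite qinvE qmulE mulgV. Qed.

HB.instance Definition _ :=
  isGroup.Build Q qmulA qmul1 q1mul qmulV qVmul.

End QuotientGroup.

(* A unit is stored together with its (unique) two-sided inverse, so that the *)
(* inverse is available although R is an arbitrary, possibly zero, ring.      *)
Section Units.
Variable R : pzRingType.

Definition inverse_pair : pred (R * R) :=
  fun x => (x.1 * x.2 == 1) && (x.2 * x.1 == 1).

Record units := Units {units_pair : R * R; _ : inverse_pair units_pair}.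

HB.instance Definition _ := [isSub for units_pair].
HB.instance Definition _ := [Choice of units by <:].

Definition uval (x : units) : R := (units_pair x).1.
Definition uinv (x : units) : R := (units_pair x).2.

Lemma uvalV (x : units) : uval x * uinv x = 1.
Proof. by have /andP[/eqP] := valP x. Qed.

Lemma uVval (x : units) : uinv x * uval x = 1.
Proof. by have /andP[_ /eqP] := valP x. Qed.

Lemma uval_inj : injective uval.
Proof.
move=> x y xy; have xyV : uinv x = uinv y.
  by rewrite -[LHS]mulr1 -(uvalV y) mulrA -xy uVval mul1r.
apply: val_inj; move: xy xyV; rewrite /uval /uinv /=.
by case: (units_pair x) (units_pair y) => [? ?] [? ?] /= -> ->.
Qed.

Lemma units_one_subproof : inverse_pair (1, 1).
Proof. by rewrite /inverse_pair /= mulr1 eqxx. Qed.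
Definition units_one := Units units_one_subproof.

Lemma units_mul_subproof (x y : units) :
  inverse_pair (uval x * uval y, uinv y * uinv x).
Proof.
rewrite /inverse_pair /= mulrA -(mulrA (uval x)) uvalV mulr1 uvalV eqxx.
by rewrite mulrA -(mulrA (uinv y)) uVval mulr1 uVval eqxx.
Qed.
Definition units_mul x y := Units (units_mul_subproof x y).

Lemma units_inv_subproof (x : units) : inverse_pair (uinv x, uval x).
Proof. by rewrite /inverse_pair /= uVval uvalV !eqxx. Qed.
Definition units_inv x := Units (units_inv_subproof x).

Lemma units_mulA : associative units_mul.
Proof. by move=> x y z; apply: uval_inj; rewrite /uval /= mulrA. Qed.

Lemma units_mul1 : left_id units_one units_mul.
Proof. by move=> x; apply: uval_inj; rewrite /uval /= mul1r. Qed.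

Lemma units_1mul : right_id units_one units_mul.
Proof. by move=> x; apply: uval_inj; rewrite /uval /= mulr1. Qed.

Lemma units_mulV : left_inverse units_one units_inv units_mul.
Proof. by move=> x; apply: uval_inj; apply: uVval. Qed.

Lemma units_Vmul : right_inverse units_one units_inv units_mul.
Proof. by move=> x; apply: uval_inj; apply: uvalV. Qed.

HB.instance Definition _ :=
  isGroup.Build units units_mulA units_mul1 units_1mul units_mulV units_Vmul.

End Units.

(* The library's ring structures on 'End(U) require U to be nonzero.          *)
Section Endomorphisms.
Variables (k : fieldType) (U : vectType k).

(* Operators written on the left: (f * g) u = f (g u).                        *)
Definition lend : Type := 'End(U).
HB.instance Definition _ := GRing.Zmodule.on lend.

Definition lend_mul (f g : lend) : lend := (f \o g)%VF.

Lemma lend_mulDl : left_distributive lend_mul +%R.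
Proof. by move=> f g h; apply: comp_lfunDl. Qed.
Lemma lend_mulDr : right_distributive lend_mul +%R.
Proof. by move=> f g h; apply: comp_lfunDr. Qed.

HB.instance Definition _ := GRing.Zmodule_isPzRing.Build lend
  (@comp_lfunA _ U U U U) (@comp_lfun1l _ U U) (@comp_lfun1r _ U U)
  lend_mulDl lend_mulDr.

(* Operators written on the right: u (f * g) = (u f) g.                       *)
Definition rend : Type := lend^c.
HB.instance Definition _ := GRing.PzRing.on rend.

Definition lapp (f : lend) (u : U) : U := (f : 'End(U)) u.
Definition rapp (u : U) (f : rend) : U := (f : 'End(U)) u.

Definition GLr := units rend.
HB.instance Definition _ := Group.on GLr.

Lemma lapp1 u : lapp 1 u = u.
Proof. exact: id_lfunE. Qed.
Lemma lappB f g u : lapp (f - g) u = lapp f u - lapp g u.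
Proof. by rewrite /lapp add_lfunE opp_lfunE. Qed.
Lemma lappM f g u : lapp (f * g) u = lapp f (lapp g u).
Proof. exact: comp_lfunE. Qed.

Lemma rapp1 u : rapp u 1 = u.
Proof. exact: id_lfunE. Qed.
Lemma rappB f g u : rapp u (f - g) = rapp u f - rapp u g.
Proof. exact: lappB. Qed.
Lemma rappM f g u : rapp u (f * g) = rapp (rapp u f) g.
Proof. exact: lappM. Qed.

Lemma rappKV (f : GLr) u : rapp (rapp u (uinv f)) (uval f) = u.
Proof. by rewrite -rappM uVval rapp1. Qed.

Lemma rappK (f : GLr) u : rapp (rapp u (uval f)) (uinv f) = u.
Proof. by rewrite -rappM uvalV rapp1. Qed.

End Endomorphisms.

Section Bilinear.
Variables (k : fieldType) (U V W : vectType k).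
Variable mul : {bilinear U -> V -> W}.

(* (f, g; h) is encoded as ((f, g), h). *)
Definition autotopisms : {pred GLr U * GLr V * GLr W} := fun t =>
  `[< forall u v, mul (rapp u (uval t.1.1)) (rapp v (uval t.1.2)) =
                  rapp (mul u v) (uval t.2) >].

Lemma autotopisms_closed : group_closed autotopisms.
Proof.
split=> [|s t /asboolP sP /asboolP tP]; apply/asboolP => u v /=.
  by rewrite !rapp1.
have := tP (rapp (rapp u (uval s.1.1)) (uinv t.1.1))
           (rapp (rapp v (uval s.1.2)) (uinv t.1.2)).
by rewrite !rappKV sP !rappM => ->; rewrite rappK.
Qed.

Definition autotopism_group := subgroup autotopisms_closed.
HB.instance Definition _ := Group.on autotopism_group.

Definition left_scalars : {pred lend U * lend W} := fun l =>
  `[< forall u v, mul (lapp l.1 u) v = lapp l.2 (mul u v) >].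

Definition mid_scalars : {pred rend U * lend V} := fun m =>
  `[< forall u v, mul (rapp u m.1) v = mul u (lapp m.2 v) >].

Definition right_scalars : {pred rend V * rend W} := fun r =>
  `[< forall u v, mul u (rapp v r.1) = rapp (mul u v) r.2 >].

Lemma left_scalars_subring : subring_closed left_scalars.
Proof.
split=> [|l m /asboolP lP /asboolP mP|l m /asboolP lP /asboolP mP]; apply/asboolP => u v /=.
- by rewrite !lapp1.
- by rewrite !lappB linearBl lP mP.
- by rewrite !lappM lP mP.
Qed.

Lemma mid_scalars_subring : subring_closed mid_scalars.
Proof.
split=> [|l m /asboolP lP /asboolP mP|l m /asboolP lP /asboolP mP]; apply/asboolP => u v /=.
- by rewrite rapp1 lapp1.
- by rewrite rappB lappB linearBl linearBr lP mP.
- by rewrite rappM lappM mP lP.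
Qed.

Lemma right_scalars_subring : subring_closed right_scalars.
Proof.
split=> [|l m /asboolP lP /asboolP mP|l m /asboolP lP /asboolP mP]; apply/asboolP => u v /=.
- by rewrite !rapp1.
- by rewrite !rappB linearBr lP mP.
- by rewrite !rappM mP lP.
Qed.

Record Lring := LRing {Lval : lend U * lend W; _ : Lval \in left_scalars}.
HB.instance Definition _ := [isSub for Lval].
HB.instance Definition _ := [Choice of Lring by <:].
HB.instance Definition _ := GRing.SubChoice_isSubPzRing.Build
  _ _ Lring left_scalars_subring.

Record Mring := MRing {Mval : rend U * lend V; _ : Mval \in mid_scalars}.
HB.instance Definition _ := [isSub for Mval].
HB.instance Definition _ := [Choice of Mring by <:].
HB.instance Definition _ := GRing.SubChoice_isSubPzRing.Build
  _ _ Mring mid_scalars_subring.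

Record Rring := RRing {Rval : rend V * rend W; _ : Rval \in right_scalars}.
HB.instance Definition _ := [isSub for Rval].
HB.instance Definition _ := [Choice of Rring by <:].
HB.instance Definition _ := GRing.SubChoice_isSubPzRing.Build
  _ _ Rring right_scalars_subring.

Definition LMRring : Type := (Lring * Mring * Rring)%type.
HB.instance Definition _ := GRing.PzRing.on LMRring.

Definition Lpart (x : LMRring) : lend U * lend W := Lval x.1.1.
Definition Mpart (x : LMRring) : rend U * lend V := Mval x.1.2.
Definition Rpart (x : LMRring) : rend V * rend W := Rval x.2.

(* lambda^-1 u mu is bracketed as (lambda^-1 u) mu, and similarly on V and W. *)
(* The other bracketing agrees as soon as mul is nondegenerate in both        *)
(* arguments and its image spans W.                                           *)
Definition inner_autotopisms : {pred GLr U * GLr V * GLr W} := fun t =>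
  `[< exists x : units LMRring,
      [/\ forall u, rapp u (uval t.1.1) =
            rapp (lapp (Lpart (uinv x)).1 u) (Mpart (uval x)).1,
          forall v, rapp v (uval t.1.2) =
            rapp (lapp (Mpart (uinv x)).2 v) (Rpart (uval x)).1
        & forall w, rapp w (uval t.2) =
            rapp (lapp (Lpart (uinv x)).2 w) (Rpart (uval x)).2] >].

End Bilinear.

(* The library's {'GL_n[R]} needs a finite R.                                 *)
Section GeneralLinear.
Variables (n : nat) (k : fieldType).

Record GL := MkGL {GL_mx : 'M[k]_n; _ : GL_mx \in unitmx}.
HB.instance Definition _ := [isSub for GL_mx].
HB.instance Definition _ := [Choice of GL by <:].

Lemma GL_unit (A : GL) : GL_mx A \in unitmx.
Proof. exact: (valP A). Qed.

Definition GL_one := MkGL (unitmx1 k n).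

Lemma GL_mul_subproof (A B : GL) : GL_mx A *m GL_mx B \in unitmx.
Proof. by rewrite unitmx_mul !GL_unit. Qed.
Definition GL_mul A B := MkGL (GL_mul_subproof A B).

Lemma GL_inv_subproof (A : GL) : invmx (GL_mx A) \in unitmx.
Proof. by rewrite unitmx_inv GL_unit. Qed.
Definition GL_inv A := MkGL (GL_inv_subproof A).

Lemma GL_mulA : associative GL_mul.
Proof. by move=> A B C; apply: val_inj; apply: mulmxA. Qed.
Lemma GL_mul1 : left_id GL_one GL_mul.
Proof. by move=> A; apply: val_inj; apply: mul1mx. Qed.
Lemma GL_1mul : right_id GL_one GL_mul.
Proof. by move=> A; apply: val_inj; apply: mulmx1. Qed.
Lemma GL_mulV : left_inverse GL_one GL_inv GL_mul.
Proof. by move=> A; apply: val_inj; apply/mulVmx/GL_unit. Qed.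
Lemma GL_Vmul : right_inverse GL_one GL_inv GL_mul.
Proof. by move=> A; apply: val_inj; apply/mulmxV/GL_unit. Qed.

HB.instance Definition _ :=
  isGroup.Build GL GL_mulA GL_mul1 GL_1mul GL_mulV GL_Vmul.

End GeneralLinear.

Section ScalarTriples.
Variables (a b c : nat) (k : fieldType).

Definition scalar_triples : {pred GL a k * GL b k * GL c k} := fun t =>
  `[< exists s : k, s != 0 /\
      [/\ GL_mx t.1.1 = s%:M, GL_mx t.1.2 = s%:M & GL_mx t.2 = s%:M] >].

Lemma scalar_triples_closed : group_closed scalar_triples.
Proof.
split=> [|x y /asboolP[s [s0 [s1 s2 s3]]] /asboolP[t [t0 [t1 t2 t3]]]].
  by apply/asboolP; exists 1; rewrite oner_neq0.
apply/asboolP; exists (s / t); rewrite mulf_neq0 ?invr_eq0 //.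
by split=> //; split; rewrite /= ?(s1, s2, s3) ?(t1, t2, t3) invmx_scalar -scalar_mxM.
Qed.

Lemma scalar_conj n (A B : GL n k) s :
  GL_mx A = s%:M -> GL_mx (A ^ B)%g = s%:M.
Proof. by move=> As /=; rewrite As -scalar_mxC mulKmx // GL_unit. Qed.

Lemma scalar_triples_conj : conj_closed scalar_triples.
Proof.
move=> x y /asboolP[s [s0 [s1 s2 s3]]]; apply/asboolP; exists s; split=> //.
by split; apply: scalar_conj.
Qed.

Definition scalar_quotient :=
  quotient_group scalar_triples_closed scalar_triples_conj.
HB.instance Definition _ := Group.on scalar_quotient.

End ScalarTriples.

(* Main.v *)
Require Import Defs.
From HB Require Import structures.
From mathcomp Require Import all_boot all_algebra boolp.

Set Implicit Arguments.
Unset Strict Implicit.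
Unset Printing Implicit Defensive.

Import GRing.Theory.
Local Open Scope ring_scope.

(** Every inner autotopism is an autotopism, for any bilinear map, because the
    defining identities of the three rings of scalars let the factors cancel.
    For matrices the triple attached to invertible (A, B, C) is
      X |-> A^-1 X B,   Y |-> B^-1 Y C,   Z |-> A^-1 Z C,
    and it is inner because left multiplications, right multiplications, and
    the two multiplications on the middle side are left, right and mid scalars.

    The content is that each autotopism (F, G; H) has this form
    ([autotopism_sandwich]).  No structure theory of matrix algebras is used:
    evaluate F(X) G(Y) = H(X Y) at the Y which have w in column l as their only
    nonzero column, and read off column q of the result.  The maps
    w |-> column q of G(Y) and u |-> column q of H(the same matrix with u in
    place of w) are linear, hence given by square matrices Q and P, and the
    identity becomes F(X) Q = P X for all X ([column_matrix_intertwine]).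
    If G(E_{j,l}) has a nonzero entry in column q then Q is nonzero, and
    bijectivity of F forces Q and P to be invertible; so F(X) = P X Q^-1.
    After cancelling P and Q, F becomes the identity, and the same reading-off
    with rows instead of columns shows that G and H are both right
    multiplication by one matrix ([row_matrix_intertwine]); H is covered since
    every matrix is a sum of products.

    Consequently (A, B, C) |-> the triple above is a surjective homomorphism
    onto the autotopism group.  Its kernel consists of the triples for which
    A X = X B and B Y = Y C always hold, and testing on elementary matrices
    shows that A, B, C are then the same scalar ([intertwine_all_mx]).  The
    isomorphism is the first isomorphism theorem. *)

(** * Elementary matrices *)

Section MatrixAux.
Variable k : fieldType.

Lemma mulmx_deltaE m n p (A : 'M[k]_(m, n)) (j : 'I_n) (l : 'I_p) i q :
  (A *m delta_mx j l) i q = A i j *+ (q == l).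
Proof.
rewrite mxE (bigD1 j) //= big1 => [|s /negPf sj]; rewrite mxE ?sj ?mulr0 //.
by rewrite eqxx addr0 mulr_natr.
Qed.

Lemma delta_mulmxE m n p (A : 'M[k]_(n, p)) (i : 'I_m) (j : 'I_n) r q :
  (delta_mx i j *m A) r q = A j q *+ (r == i).
Proof.
rewrite mxE (bigD1 j) //= big1 => [|s /negPf sj]; rewrite mxE ?sj ?andbF ?mul0r //.
by rewrite eqxx andbT addr0 mulr_natl.
Qed.

Lemma mulmx_delta_sum m n p (A : 'M[k]_(m, n)) (j : 'I_n) (l : 'I_p) :
  A *m delta_mx j l = \sum_s A s j *: delta_mx s l.
Proof.
apply/matrixP => r t; rewrite mulmx_deltaE summxE (bigD1 r) //= big1 => [|s /negPf sr].
  by rewrite !mxE eqxx addr0 mulr_natr.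
by rewrite !mxE eq_sym sr mulr0.
Qed.

Lemma delta_mulmx_sum m n p (A : 'M[k]_(n, p)) (i : 'I_m) (j : 'I_n) :
  delta_mx i j *m A = \sum_s A j s *: delta_mx i s.
Proof.
apply/matrixP => r t; rewrite delta_mulmxE summxE (bigD1 t) //= big1 => [|s /negPf st].
  by rewrite !mxE eqxx andbT addr0 mulr_natr.
by rewrite !mxE [t == s]eq_sym st andbF mulr0.
Qed.

Lemma unitmx_cancel_right n (A : 'M[k]_n) :
  (forall v : 'rV_n, v *m A = 0 -> v = 0) -> A \in unitmx.
Proof. by move=> Ainj; rewrite -row_free_unit; apply: inj_row_free. Qed.

Lemma unitmx_cancel_left n (A : 'M[k]_n) :
  (forall v : 'cV_n, A *m v = 0 -> v = 0) -> A \in unitmx.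
Proof.
move=> Ainj; rewrite -unitmx_tr; apply: unitmx_cancel_right => v vA.
by apply: trmx_inj; rewrite trmx0; apply: Ainj; rewrite -[A]trmxK -trmx_mul vA trmx0.
Qed.

(** Intertwining every rectangular matrix is as rigid as commuting with every
    square one: E_{r,s} compares column r of [A] with row s of [B]. *)
Lemma intertwine_all_mx m n (i : 'I_m) (j : 'I_n) (A : 'M[k]_m) (B : 'M[k]_n) :
  (forall X : 'M_(m, n), A *m X = X *m B) ->
  A = (A i i)%:M /\ B = (A i i)%:M.
Proof.
move=> AB.
have E r s p q : A p r *+ (q == s) = B s q *+ (p == r).
  by rewrite -mulmx_deltaE -delta_mulmxE AB.
have Bjj : B j j = A i i by have := E i j i j; rewrite !eqxx.
split; apply/matrixP => p q; rewrite mxE.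
  by have := E q j p j; rewrite eqxx Bjj.
by have := E i p i q; rewrite eqxx mulr1n [q == p]eq_sym => <-.
Qed.

(** The matrix form of the fact that products span the codomain, which needs
    only that the inner dimension is positive. *)
Lemma delta_factor_sum a b c (j : 'I_b) (Z : 'M[k]_(a, c)) :
  Z = \sum_i (delta_mx i j : 'M_(a, b)) *m (delta_mx j i *m Z).
Proof.
apply/matrixP => p q; rewrite summxE (bigD1 p) //= big1 => [|s /negPf sp].
  by rewrite addr0 !delta_mulmxE !eqxx.
by rewrite delta_mulmxE eq_sym sp.
Qed.

End MatrixAux.

(** * Reading off matrices from an autotopism *)

Section Intertwiners.
Variables (k : fieldType) (a b c : nat).
Variables (F : {linear 'M[k]_(a, b) -> 'M[k]_(a, b)}).
Variables (G : {linear 'M[k]_(b, c) -> 'M[k]_(b, c)}).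
Variables (H : {linear 'M[k]_(a, c) -> 'M[k]_(a, c)}).
Hypothesis FGH : forall X Y, F X *m G Y = H (X *m Y).

(** The matrix of w |-> column [q] of K(W), where W has column [l] equal to w and
    all other columns zero. *)
Definition column_matrix {m n} (K : 'M[k]_(m, n) -> 'M[k]_(m, n)) (l q : 'I_n) : 'M[k]_m :=
  \matrix_(i, j) K (delta_mx j l) i q.

(** Both sides describe column [q] of F(X) G(Y) = H(X Y), for [Y] supported on
    column [l]: then X Y is supported on column [l] as well. *)
Lemma column_matrix_intertwine l q X :
  F X *m column_matrix G l q = column_matrix H l q *m X.
Proof.
apply/matrixP => i j; transitivity ((F X *m G (delta_mx j l)) i q).
  by rewrite !mxE; apply: eq_bigr => s _; rewrite mxE.
rewrite FGH mulmx_delta_sum raddf_sum /= summxE mxE; apply: eq_bigr => s _.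
by rewrite linearZ !mxE mulrC.
Qed.

(** When F is the identity, row [i] of G(Y) is row [i0] of E_{i0,i} G(Y) =
    H(E_{i0,i} Y), and this depends linearly on row [i] of [Y] alone, by a matrix
    that is the same for every [i]. *)
Lemma row_matrix_intertwine (i0 : 'I_a) :
  (forall X, F X = X) ->
  let C := \matrix_(i, j) H (delta_mx i0 i) i0 j in
  forall Y, G Y = Y *m C.
Proof.
move=> FX C Y; apply/matrixP => i j.
transitivity ((delta_mx i0 i *m G Y) i0 j); first by rewrite delta_mulmxE eqxx.
rewrite -[delta_mx _ _ in LHS]FX FGH delta_mulmx_sum raddf_sum /= summxE mxE; apply: eq_bigr => s _.
by rewrite linearZ !mxE.
Qed.

End Intertwiners.

(** A vector killed by Q would give P = 0, hence Q = 0 by surjectivity of F,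
    against the choice of the entry ([p], [q]). Once Q is invertible, P u = 0
    means that F kills the nonzero matrices u e^T, so injectivity of F handles P;
    likewise injectivity of G handles the matrix C. *)
Lemma autotopism_sandwich (k : fieldType) (a b c : nat)
    (i0 : 'I_a) (j0 : 'I_b) (l0 : 'I_c)
    (F : {linear 'M[k]_(a, b) -> 'M[k]_(a, b)})
    (G : {linear 'M[k]_(b, c) -> 'M[k]_(b, c)})
    (H : {linear 'M[k]_(a, c) -> 'M[k]_(a, c)}) :
    (forall X Y, F X *m G Y = H (X *m Y)) ->
    injective F -> (forall X, exists X', F X' = X) -> injective G ->
  exists (A : GL a k) (B : GL b k) (C : GL c k),
    [/\ forall X, F X = invmx (GL_mx A) *m X *m GL_mx B,
        forall Y, G Y = invmx (GL_mx B) *m Y *m GL_mx C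
      & forall Z, H Z = invmx (GL_mx A) *m Z *m GL_mx C].
Proof.
move=> FGH Finj Fsurj Ginj.
have delta_neq0 m n (i : 'I_m) (j : 'I_n) : delta_mx i j != 0 :> 'M[k]_(m, n).
  by apply/eqP => /matrixP/(_ i j)/eqP; rewrite !mxE !eqxx oner_eq0.
have [p [q Gpq]] : exists p q, G (delta_mx j0 l0) p q != 0.
  suff:  G (delta_mx j0 l0) != 0 by move/matrix0Pn=> [p [q Gpq]]; exists p, q.
  by rewrite -(raddf0 G) (inj_eq Ginj) delta_neq0.
set Q := column_matrix G l0 q; set P := column_matrix H l0 q.
have FQ X : F X *m Q = P *m X := column_matrix_intertwine FGH l0 q X.
have Qu : Q \in unitmx.
  apply: unitmx_cancel_left => w Qw; apply/eqP/negP => /negP/matrix0Pn[s [t wst]].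
  suff P0 : P = 0.
    (* F X = E_{i0,p} makes the (i0, j0) entry of F X *m Q equal to Q p j0, which
       is the nonzero entry of G (E_{j0,l0}). *)
    have [X FX] := Fsurj (delta_mx i0 p); have := FQ X; rewrite P0 mul0mx FX.
    move=> /matrixP/(_ i0 j0); rewrite delta_mulmxE eqxx !mxE.
    by move/eqP; apply/negP.
  (* E_{r,s} w is a nonzero multiple of the basis vector e_r, so column r of P
     vanishes. *)
  apply/matrixP => i r; have : P *m (delta_mx r s *m w) = 0.
    by rewrite mulmxA -FQ -mulmxA Qw mulmx0.
  move=> /matrixP/(_ i t); rewrite mxE [RHS]mxE (bigD1 r) //= big1 => [|x /negPf xr].
    by rewrite addr0 delta_mulmxE eqxx mulr1n => /eqP; rewrite mulf_eq0 (negPf wst) orbF [RHS]mxE => /eqP.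
  by rewrite delta_mulmxE xr mulr0.
have Pu : P \in unitmx.
  apply: unitmx_cancel_left => u Pu.
  have: F (u *m delta_mx 0 j0) = 0.
    by rewrite -[LHS](mulmxK Qu) FQ mulmxA Pu !mul0mx.
  rewrite -(raddf0 F) => /Finj/matrixP u0; apply/matrixP => i j.
  by have := u0 i j0; rewrite mulmx_deltaE eqxx ord1 !mxE.
have FE X : F X = P *m X *m invmx Q by rewrite -FQ mulmxK.
(* Dividing by P and Q turns the triple into one with first component idfun. *)
pose G' : {linear 'M[k]_(b, c) -> 'M[k]_(b, c)} := mulmx (invmx Q) \o G.
pose H' : {linear 'M[k]_(a, c) -> 'M[k]_(a, c)} := mulmx (invmx P) \o H.
have GH' X Y : idfun X *m G' Y = H' (X *m Y).
  by rewrite /= -FGH FE !mulmxA mulVmx // mul1mx.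
set C := \matrix_(i, j) H' (delta_mx i0 i) i0 j.
have G'E Y : G' Y = Y *m C := @row_matrix_intertwine _ _ _ _ idfun G' H' GH' i0 (fun=> erefl) Y.
have Cu : C \in unitmx.
  apply: unitmx_cancel_right => v vC.
  have : G (delta_mx j0 0 *m v) = 0.
    have : G' (delta_mx j0 0 *m v) = 0 by rewrite G'E -mulmxA vC mulmx0.
    by move=> /(canRL (mulKVmx Qu)); rewrite mulmx0.
  rewrite -(raddf0 G) => /Ginj/matrixP v0; apply/matrixP => i j.
  by have := v0 j0 j; rewrite delta_mulmxE eqxx ord1 !mxE.
have H'E Z : H' Z = Z *m C.
  rewrite [Z in LHS](delta_factor_sum j0) raddf_sum [Z in RHS](delta_factor_sum j0).
  rewrite mulmx_suml; apply: eq_bigr => i _.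
  by rewrite -mulmxA -G'E; apply/esym/GH'.
have Pu' : invmx P \in unitmx by rewrite unitmx_inv.
have Qu' : invmx Q \in unitmx by rewrite unitmx_inv.
exists (MkGL Pu'), (MkGL Qu'), (MkGL Cu); split=> [X|Y|Z] /=; rewrite ?invmxK //.
- by rewrite -mulmxA -G'E /= mulKVmx.
- by rewrite -mulmxA -H'E /= mulKVmx.
Qed.

(** * The first isomorphism theorem *)

Section FirstIsomorphism.
Variables (G H : groupType) (N : {pred G}).
Hypotheses (gN : group_closed N) (nN : conj_closed N).
Variable phi : G -> H.
Hypothesis phiM : {morph phi : x y / (x * y)%g}.
Hypothesis phi_surj : forall y, exists x, phi x = y.
Hypothesis phi_ker : forall x, (x \in N) = (phi x == 1%g).

Local Notation Q := (quotient_group gN nN).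

Lemma pi_eq_morph x y : (\pi_Q x = \pi_Q y)%qT <-> phi x = phi y.
Proof.
have -> : (\pi_Q x = \pi_Q y)%qT <-> (x^-1 * y)%g \in N.
  by split=> /(cosetrP gN nN).
have phi1 : phi 1%g = 1%g by apply: (mulgI (phi 1%g)); rewrite -phiM !mulg1.
have phiV z : phi z^-1%g = (phi z)^-1%g.
  by apply: (mulgI (phi z)); rewrite -phiM !mulgV.
rewrite phi_ker phiM phiV; split=> [/eqP|->]; last by rewrite mulVg.
by move/(canRL (mulVKg _)); rewrite mulg1 => ->.
Qed.

(** The inverse of the induced map. Choosing a preimage avoids factoring [phi]
    through the quotient, since [pi_eq_morph] makes the class independent of the
    choice. *)
Definition lift_class (y : H) : Q := (\pi_Q (projT1 (cid (phi_surj y))))%qT.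

Lemma lift_class_morph x : lift_class (phi x) = (\pi_Q x)%qT.
Proof. by apply/pi_eq_morph; case: cid. Qed.

Lemma lift_classM : {morph lift_class : x y / (x * y)%g}.
Proof.
move=> y z; have [[x <-] [t <-]] := (phi_surj y, phi_surj z).
rewrite -phiM !lift_class_morph; symmetry; exact: qmulE.
Qed.

HB.instance Definition _ := isMultiplicative.Build H Q lift_class lift_classM.

Lemma first_isomorphism : isomorphic H Q.
Proof.
exists lift_class; exists (fun x : Q => phi (repr x)) => [y|q].
  have [x <-] := phi_surj y; apply/pi_eq_morph.
  by rewrite reprK; apply: lift_class_morph.
by rewrite -[RHS]reprK; apply: lift_class_morph.
Qed.

End FirstIsomorphism.

(** * Inner autotopisms *)

Section Inner.
Variables (k : fieldType) (U V W : vectType k) (mul : {bilinear U -> V -> W}).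

(** Write u' for lambda^-1 u and v' for mu^-1 v. Moving rho, then mu, then
    lambda^-1 through the product gives (u' mu)(v' rho) = ((u' mu) v') rho =
    (u' (mu v')) rho = (u' v) rho = (lambda^-1 (u v)) rho. *)
Lemma inner_sub_autotopisms : {subset inner_autotopisms mul <= autotopisms mul}.
Proof.
move=> t /asboolP[x [tU tV tW]]; apply/asboolP => u v.
have /asboolP lP := valP (uinv x).1.1.
have /asboolP mP := valP (uval x).1.2.
have /asboolP rP := valP (uval x).2.
have mK w : lapp (Mpart (uval x)).2 (lapp (Mpart (uinv x)).2 w) = w.
  rewrite -lappM -[RHS]lapp1; congr lapp.
  by have /(congr1 (fun y => (Mpart y).2)) := uvalV x.
by rewrite tU tV tW rP mP mK lP.
Qed.

Lemma GLr_ext (f g : GLr U) :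
  (forall u, rapp u (uval f) = rapp u (uval g)) -> f = g.
Proof. by move=> fg; apply: uval_inj; apply/lfunP => u; apply: fg. Qed.

End Inner.

(** * The homomorphism from triples of invertible matrices *)

Section Sandwich.
Variable k : fieldType.

Definition sandwich_lfun {m n} (A : 'M[k]_m) (B : 'M[k]_n) : 'End('M[k]_(m, n)) :=
  linfun (mulmxr B \o mulmx A).

Lemma sandwich_lfunE m n (A : 'M[k]_m) (B : 'M[k]_n) X :
  sandwich_lfun A B X = A *m X *m B.
Proof. by rewrite lfunE. Qed.

Lemma sandwich_unit_subproof m n (A : GL m k) (B : GL n k) :
  @inverse_pair (rend 'M[k]_(m, n))
    (sandwich_lfun (invmx (GL_mx A)) (GL_mx B),
     sandwich_lfun (GL_mx A) (invmx (GL_mx B))).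
Proof.
have [Au Bu] := (Defs.GL_unit A, Defs.GL_unit B).
apply/andP; split; apply/eqP/lfunP => X; rewrite comp_lfunE id_lfunE !sandwich_lfunE.
  by rewrite !mulmxA mulmxV // mul1mx mulmxK.
by rewrite !mulmxA mulVmx // mul1mx mulmxKV.
Qed.

Definition sandwich {m n} (A : GL m k) (B : GL n k) : GLr 'M[k]_(m, n) :=
  Units (sandwich_unit_subproof A B).

Lemma sandwichE m n (A : GL m k) (B : GL n k) X :
  rapp X (uval (sandwich A B)) = invmx (GL_mx A) *m X *m GL_mx B.
Proof. exact: sandwich_lfunE. Qed.

(** The inverse on the left factor matches the right-hand convention for
    operators: composing X |-> A^-1 X B with X |-> A'^-1 X B' gives the map of the
    products A A' and B B', in this order. *)
Lemma sandwichM m n (A A' : GL m k) (B B' : GL n k) :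
  sandwich (A * A')%g (B * B')%g = (sandwich A B * sandwich A' B')%g.
Proof.
apply: GLr_ext => X; rewrite rappM !sandwichE.
have -> : invmx (GL_mx (A * A')%g) = invmx (GL_mx A') *m invmx (GL_mx A).
  by have := congr1 (@GL_mx m k) (invgM A A').
by rewrite !mulmxA.
Qed.

Lemma sandwich_eq1 m n (A : GL m k) (B : GL n k) :
  sandwich A B = 1%g <-> forall X, GL_mx A *m X = X *m GL_mx B.
Proof.
split=> [AB1 X | AB].
  have := sandwichE A B X; rewrite AB1 rapp1 -mulmxA => XE.
  by rewrite {1}XE mulKVmx ?Defs.GL_unit.
by apply: GLr_ext => X; rewrite sandwichE rapp1 -mulmxA -AB mulKmx ?Defs.GL_unit.
Qed.

End Sandwich.

Section MatrixAutotopisms.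
Variables (k : fieldType) (a b c : nat).
Local Notation mul :=
  (@mulmx k a b c : {bilinear 'M[k]_(a, b) -> 'M[k]_(b, c) -> 'M[k]_(a, c)}).

Definition sandwich_triple (t : GL a k * GL b k * GL c k) :=
  (sandwich t.1.1 t.1.2, sandwich t.1.2 t.2, sandwich t.1.1 t.2).

Lemma sandwich_triple_autotopism t : sandwich_triple t \in autotopisms mul.
Proof.
apply/asboolP => X Y; rewrite !sandwichE /= -!mulmxA; congr (_ *m (_ *m _)).
by rewrite mulKVmx ?Defs.GL_unit.
Qed.

(** The scalars are lambda = left multiplication by A, mu = multiplication by B
    on the side facing the other factor, rho = right multiplication by C. *)
Lemma sandwich_triple_inner t : sandwich_triple t \in inner_autotopisms mul.
Proof.
case: t => [[A B] C]; have [Au Bu Cu] := And3 (Defs.GL_unit A) (Defs.GL_unit B) (Defs.GL_unit C).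
pose Lp (P : 'M[k]_a) : lend 'M[k]_(a, b) * lend 'M[k]_(a, c) :=
  (sandwich_lfun P 1%:M, sandwich_lfun P 1%:M).
pose Mp (P : 'M[k]_b) : rend 'M[k]_(a, b) * lend 'M[k]_(b, c) :=
  (sandwich_lfun 1%:M P, sandwich_lfun P 1%:M).
pose Rp (P : 'M[k]_c) : rend 'M[k]_(b, c) * rend 'M[k]_(a, c) :=
  (sandwich_lfun 1%:M P, sandwich_lfun 1%:M P).
have lP P : Lp P \in left_scalars mul.
  by apply/asboolP => X Y; rewrite /lapp !sandwich_lfunE /= !mulmx1 mulmxA.
have mP P : Mp P \in mid_scalars mul.
  by apply/asboolP => X Y; rewrite /lapp /rapp !sandwich_lfunE /= !mul1mx !mulmx1 mulmxA.
have rP P : Rp P \in right_scalars mul.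
  by apply/asboolP => X Y; rewrite /rapp !sandwich_lfunE /= !mul1mx mulmxA.
pose x P Q R : LMRring mul := (LRing (lP P), MRing (mP Q), RRing (rP R)).
have xM P Q R P' Q' R' : P *m P' = 1%:M -> Q *m Q' = 1%:M -> R *m R' = 1%:M ->
    x P Q R * x P' Q' R' = 1.
  move=> PP QQ RR; congr (_, _, _); apply: val_inj; congr (_, _);
    apply/lfunP => X; rewrite comp_lfunE id_lfunE !sandwich_lfunE !(mul1mx, mulmx1);
    by [rewrite mulmxA ?(PP, QQ) mul1mx | rewrite -mulmxA ?(QQ, RR) mulmx1].
have xu : inverse_pair (x (GL_mx A) (GL_mx B) (GL_mx C),
    x (invmx (GL_mx A)) (invmx (GL_mx B)) (invmx (GL_mx C))).
  by apply/andP; split; apply/eqP; apply: xM; rewrite ?mulmxV ?mulVmx.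
apply/asboolP; exists (Units xu); split=> X; rewrite sandwichE /lapp /rapp /=;
  by rewrite !sandwich_lfunE !mul1mx mulmx1.
Qed.

Definition sandwich_autotopism t : autotopism_group mul :=
  Subgroup (autotopisms_closed mul) (sandwich_triple_autotopism t).

Lemma sandwich_autotopismM : {morph sandwich_autotopism : s t / (s * t)%g}.
Proof.
move=> s t; apply: val_inj; rewrite gmulfM; congr (_, _, _); exact: sandwichM.
Qed.

Hypotheses (ha : (0 < a)%N) (hb : (0 < b)%N) (hc : (0 < c)%N).

Lemma sandwich_triple_surj s :
  s \in autotopisms mul -> exists t, sandwich_triple t = s.
Proof.
case: s => [[f g] h] /asboolP fgh.
have [A [B [C [fE gE hE]]]] := @autotopism_sandwich k a b c
  (Ordinal ha) (Ordinal hb) (Ordinal hc)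
  (uval f : 'End(_)) (uval g : 'End(_)) (uval h : 'End(_)) fgh
  (can_inj (rappK f)) (fun X => ex_intro _ _ (rappKV f X)) (can_inj (rappK g)).
exists (A, B, C); congr (_, _, _); apply: GLr_ext => X; rewrite sandwichE;
  by [rewrite -fE | rewrite -gE | rewrite -hE].
Qed.

(** The middle matrix links the two: A X = X B makes A and B the same scalar, and
    B Y = Y C extends it to C. *)
Lemma sandwich_autotopism_ker (t : GL a k * GL b k * GL c k) :
  (t \in @scalar_triples a b c k) = (sandwich_autotopism t == 1%g).
Proof.
case: t => [[A B] C]; apply/asboolP/eqP => [[s [_ [/= As Bs Cs]]] | ABC1].
  apply: val_inj; congr (_, _, _); apply/sandwich_eq1 => X;
    by rewrite /= ?(As, Bs, Cs) scalar_mxC.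
have AB : sandwich A B = 1%g := congr1 (fun x => (val x).1.1) ABC1.
have BC : sandwich B C = 1%g := congr1 (fun x => (val x).1.2) ABC1.
pose i := Ordinal ha; pose j := Ordinal hb; pose l := Ordinal hc.
have [As Bs] := intertwine_all_mx i j ((sandwich_eq1 A B).1 AB).
have [_ Cs] := intertwine_all_mx j l ((sandwich_eq1 B C).1 BC).
exists (GL_mx A i i); split; last by split=> //=; rewrite Cs [in LHS]Bs mxE eqxx.
apply/eqP => s0; have /matrixP/(_ i i) := mulmxV (Defs.GL_unit A).
by rewrite As s0 raddf0 mul0mx !mxE eqxx => /esym/eqP; rewrite oner_eq0.
Qed.

End MatrixAutotopisms.

(** * The theorem *)

Theorem theorem1p4 (k : fieldType) (a b c : nat)
    (ha : (0 < a)%N) (hb : (0 < b)%N) (hc : (0 < c)%N) :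
  let mul : {bilinear 'M[k]_(a, b) -> 'M[k]_(b, c) -> 'M[k]_(a, c)} :=
    @mulmx k a b c in
  autotopisms mul =i inner_autotopisms mul /\
  isomorphic (autotopism_group mul) (scalar_quotient a b c k).
Proof.
move=> mul; split=> [t|].
  apply/idP/idP; last exact: inner_sub_autotopisms.
  by case/(sandwich_triple_surj ha hb hc) => s <-; apply: sandwich_triple_inner.
apply: (first_isomorphism _ _ (phi := @sandwich_autotopism k a b c) (@sandwich_autotopismM k a b c)).
  move=> s; have [t tE] := sandwich_triple_surj ha hb hc (valP s).
  by exists t; apply: val_inj.
by move=> t; apply: sandwich_autotopism_ker.
Qed.
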